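(* Let $h\ge 1$ and let $p_h^E(W)$ be the probability that a growing self-avoiding walk $W$ on $\mathcal G_h$ occurs under the energetic model with parameter $C$. Then the generating function $$f_h^E(x,y,C)=\sum_{W\in W_{(0,h-1)}(\mathcal G_h)}p_h^E(W)\,x^{|W|}y^{\|W\|}$$ that counts GSAWs on $\mathcal G_h$ that start in the top-left corner $(0,h-1)$ by length and displacement is rational (as a function of $x$, $y$ and $C$).
   Context: $\mathcal G_h$ is the half-infinite grid graph with vertex set $\mathbb N\times\{0,\dots,h-1\}$ ($0\in\mathbb N$), with an edge between two points exactly when they are at Euclidean distance $1$. A growing self-avoiding walk (GSAW) on a graph is a finite directed walk that visits no vertex twice and whose final vertex is trapped, i.e. all of its neighbors are visited by the walk. $W_v(G)$ denotes the set of GSAWs on $G$ starting at the vertex $v$. $|W|$ is the length of $W$ (number of edges) and $\|W\|$ is its displacement (difference between the largest and smallest $x$-coordinates of its vertices). Energetic model: let $C$ be a positive constant. Suppose $v$ is the endpoint of a partially built walk and $N(v)$ is the set of unvisited neighbors of $v$. The energy of $w\in N(v)$ is $E(w)=C^\ell$, where $\ell$ is the number of neighbors of $w$ that are already part of the walk, not counting $v$. The next vertex is $w\in N(v)$ with probability $E(w)/\sum_{w'\in N(v)}E(w')$. The probability $p_h^E(W)$ is the product of the probabilities of the steps of $W$; it is a rational function of $C$. ''Rational'' means that $f^E_h$, viewed as a formal power series in $x,y$ whose coefficients are rational functions of $C$, equals a quotient of two polynomials in $x,y,C$. *)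

(* Defs.v *)
From HB Require Import structures.
From mathcomp Require Import all_boot all_order all_algebra.
From mathcomp Require Import boolp classical_sets functions cardinality fsbigop.
From mathcomp Require Import zify.
Set Implicit Arguments.
Unset Strict Implicit.
Unset Printing Implicit Defensive.
Import GRing.Theory.
Local Open Scope classical_set_scope.
Local Open Scope ring_scope.

Notation vertex h := (nat * 'I_h)%type.

(* squared Euclidean distance 1 *)
Definition adj (h : nat) : rel (vertex h) := fun u v =>
  (u.1%:Z - v.1%:Z) ^+ 2 + (u.2%:Z - v.2%:Z) ^+ 2 == 1.

Definition topleft (h : nat) (h_gt0 : (0 < h)%N) : vertex h :=
  (0%N, Ordinal (etrans (ltn_predL h) h_gt0)).

(* As in path.v, a walk is given by its first vertex [v] and the sequence [p]
   of the vertices that follow it: its length is [size p]. *)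
Definition is_gsaw (h : nat) (v : vertex h) (p : seq (vertex h)) : Prop :=
  [/\ path (@adj h) v p, uniq (v :: p)
    & forall w, adj (last v p) w -> w \in v :: p].

Definition gsaws (h : nat) (v : vertex h) : set (seq (vertex h)) :=
  [set p | is_gsaw v p].

Definition displacement (h : nat) (v : vertex h) (p : seq (vertex h)) : nat :=
  (\big[maxn/v.1]_(u <- p) u.1 - \big[minn/v.1]_(u <- p) u.1)%N.

Section EnergeticModel.
Variables (F : fieldType) (C : F) (h : nat).
Implicit Types (u v w : vertex h) (p s : seq (vertex h)).

Definition unvisited s v : set (vertex h) :=
  [set w | adj v w /\ w \notin s].

(* [s] lists the vertices of the partially built walk, which ends at [v];
   they are pairwise distinct, so [count] counts vertices. *)
Definition energy s v w : F :=
  C ^+ count (fun u => adj w u && (u != v)) s.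

Definition step_prob s v w : F :=
  energy s v w / \sum_(w' \in unvisited s v) energy s v w'.

(* The [i]-th step goes from the [i]-th vertex of [v :: p] to the [i]-th
   vertex of [p], when the visited vertices are [v] and the first [i]
   vertices of [p]. *)
Definition gsaw_prob v p : F :=
  \prod_(i < size p)
    step_prob (v :: take i p) (nth v (v :: p) i) (nth v p i).

End EnergeticModel.

(* [\sum_(_ \in A)] is 0 on infinite supports; [finite_unvisited] and
   [finite_gsaws] show that the sums in [step_prob] and in [gsaw_gf] are
   genuine finite sums. *)
Lemma finite_adj (h : nat) (v : vertex h) : finite_set [set w | adj v w].
Proof.
apply: (@sub_finite_set _ _ (`I_v.1.+2 `*` [set: 'I_h])); last first.
  by apply: finite_setX; [exact: finite_II|exact: finite_finset].
move=> [i j]; rewrite /adj /= => /eqP vij; split=> //=.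
by rewrite ltnNge; apply/negP => lt_vi; nia.
Qed.

Lemma finite_unvisited (h : nat) (s : seq (vertex h)) (v : vertex h) :
  finite_set (unvisited s v).
Proof. by apply: sub_finite_set (finite_adj v) => w []. Qed.

Lemma finite_gsaws (h : nat) (v : vertex h) (n : nat) :
  finite_set (gsaws v `&` [set p | size p = n]).
Proof.
suff fin u : finite_set [set p | path (@adj h) u p /\ size p = n].
  by apply: sub_finite_set (fin v) => p [[pp _ _] sz].
elim: n u => [|n IHn] u.
  by apply: sub_finite_set (finite_set1 [::]) => -[|w p] [].
apply: (@sub_finite_set _ _ (\bigcup_(w in [set w | adj u w])
  (cons w @` [set p | path (@adj h) w p /\ size p = n]))).
  by move=> [|w p] [] //= /andP[uw wp] [szp]; exists w => //; exists p.
by apply: bigcup_finite => [|w _]; [exact: finite_adj|exact: finite_image].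
Qed.

(* The field Q(C) of rational functions and its indeterminate. *)
Notation ratfun := {fraction {poly rat}}.
Definition Cvar : ratfun := tofrac ('X : {poly rat}).

(* Formal power series in x and y: [f n m] is the coefficient of x^n y^m. *)
Definition fps2 (R : Type) := nat -> nat -> R.

Definition fps2_mul (R : pzRingType) (f g : fps2 R) : fps2 R := fun n m =>
  \sum_(i < n.+1) \sum_(j < m.+1) f i j * g (n - i)%N (m - j)%N.

(* An element of [{poly {poly {poly rat}}}] is a polynomial in x, whose
   coefficients are polynomials in y, whose coefficients are polynomials
   in C. *)
Definition fps2_of_poly (P : {poly {poly {poly rat}}}) : fps2 ratfun :=
  fun n m => tofrac P`_n`_m.

(* f = P / Q, in the fraction field of the domain Q(C)[[x, y]] *)
Definition is_rational (f : fps2 ratfun) : Prop :=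
  exists P Q : {poly {poly {poly rat}}},
    Q != 0 /\ fps2_mul (fps2_of_poly Q) f = fps2_of_poly P.

Definition gsaw_gf (h : nat) (v : vertex h) : fps2 ratfun := fun n m =>
  \sum_(p \in gsaws v `&` [set p | size p = n /\ displacement v p = m])
    gsaw_prob Cvar v p.

(* Main.v *)
Require Import Defs.
From mathcomp Require Import all_boot all_order all_algebra.
From mathcomp Require Import boolp classical_sets functions cardinality fsbigop.
From mathcomp Require Import generic_quotient zify.
Set Implicit Arguments.
Unset Strict Implicit.
Unset Printing Implicit Defensive.
Import GRing.Theory Num.Theory.
Local Open Scope classical_set_scope.
Local Open Scope ring_scope.

(* Transfer matrix on columns. Cut a walk from column 0 to its vertices in the
   columns up to k, kept in their order of visit: two consecutive vertices of
   the cut walk are adjacent, or both lie in column k, where the walk made an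
   excursion to the right. A cut walk up to column k + 1 amounts to a cut walk
   up to column k and a compatible ordered list of vertices in the window of
   columns a, ..., k + 1, for any a < k: after a vertex of column at most a the
   merged walk must continue in the left part, and after any other vertex it
   must continue in the right part. The factor of a step out of column j, and
   the test that the last vertex is trapped, depend only on the visits to the
   columns j - 2, ..., j + 2. So the weighted sums over cut walks with a
   prescribed window of five columns obey a linear recursion whose matrix has
   entries in Q(C)[x] and does not depend on the position of the window. By
   Cayley-Hamilton, the coefficients of y^m satisfy a linear recurrence over
   Q(C)[x], and it remains to clear the denominators in C. *)

(** * Clearing denominators in [C] *)

Lemma tofrac_num_den (R : idomainType) (x : {fraction R}) :
  exists2 d : R, d != 0 & exists c : R, tofrac d * x = tofrac c.
Proof.
elim/quotW: x => x; exists x.2; first exact: denom_ratioP.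
exists x.1; unlock tofrac; rewrite !piE; apply/eqmodP.
rewrite /= FracField.equivfE /FracField.mulf.
by rewrite !numden_Ratio ?mulf_neq0 ?oner_neq0 ?denom_ratioP ?mulr1 ?mul1r // mulrC.
Qed.

Lemma common_denominator (R : idomainType) (s : seq {fraction R}) :
  exists2 d : R, d != 0 &
    forall x, x \in s -> exists c : R, tofrac d * x = tofrac c.
Proof.
elim: s => [|x s [d d0 ds]]; first by exists 1; rewrite ?oner_neq0.
have [e e0 [c ec]] := tofrac_num_den x.
exists (d * e) => [|y]; first exact: mulf_neq0.
rewrite inE => /predU1P[->|/ds[b db]].
  by exists (d * c); rewrite !tofracM -mulrA ec.
by exists (e * b); rewrite !tofracM mulrAC db mulrC.
Qed.

(** [G] and [H] have finitely many nonzero coefficients, so one common denominator in Q[C] turns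
    both into polynomials; scaling both sides by it preserves the product identity. *)
Lemma is_rationalP (f G H : fps2 ratfun) (N : nat) :
    (forall n m, (N <= n)%N || (N <= m)%N -> G n m = 0 /\ H n m = 0) ->
    (exists n m, G n m != 0) -> fps2_mul G f = H ->
  is_rational f.
Proof.
move=> GH0 [n0 [m0 G0]] GfH.
pose s F := [seq F i j | i <- iota 0 N, j <- iota 0 N] : seq ratfun.
have [d d0 ds] := common_denominator (s G ++ s H).
have poly_of F : {subset s F <= s G ++ s H} ->
    (forall n m, (N <= n)%N || (N <= m)%N -> F n m = 0) ->
    exists P, fps2_of_poly P = (fun n m => tofrac d * F n m).
  move=> sF F0.
  (* A numerator is chosen classically; one exists whenever both indices are below [N], and only
     those are used. *)
  pose c n m := if pselect (exists b, tofrac d * F n m = tofrac b) is left e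
    then sval (cid e) else 0.
  exists (\poly_(i < N) \poly_(j < N) c i j); apply/funext => n; apply/funext => m.
  rewrite /fps2_of_poly coef_poly.
  case: ltnP => [nN|Nn]; last by rewrite coef0 tofrac0 F0 ?Nn ?mulr0.
  rewrite coef_poly.
  case: ltnP => [mN|Nm]; last by rewrite tofrac0 F0 ?Nm ?orbT ?mulr0.
  rewrite /c; case: pselect => [e|[]]; first by case: cid.
  by apply/ds/sF/allpairsP; exists (n, m); rewrite !mem_iota.
have [//||P PE] := poly_of H.
- by move=> x xs; rewrite mem_cat xs orbT.
- by move=> n m /GH0[].
have [//||Q QE] := poly_of G.
- by move=> x xs; rewrite mem_cat xs.
- by move=> n m /GH0[].
exists P, Q; split.
  apply: contraNneq G0 => Q0.
  have := congr1 (fun g => g n0 m0) QE.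
  rewrite /fps2_of_poly Q0 !coef0 tofrac0 => /esym/eqP.
  by rewrite mulf_eq0 tofrac_eq0 (negPf d0).
rewrite QE PE -GfH; apply/funext => n; apply/funext => m.
rewrite /fps2_mul mulr_sumr; apply: eq_bigr => i _.
by rewrite mulr_sumr; apply: eq_bigr => j _; rewrite mulrA.
Qed.

(** * From a transfer matrix to a linear recurrence and a rational series *)

Lemma transfer_recurrence (R : comNzRingType) (S : eqType) (X : seq S)
    (T : S -> S -> R) (U : nat -> S -> R) (c : S -> R) :
    (forall n s, s \in X -> U n.+1 s = \sum_(t <- X) T s t * U n t) ->
  exists2 q : {poly R}, q \is monic &
    forall m, \sum_(i < size q) q`_i * (\sum_(s <- X) c s * U (m + i)%N s) = 0.
Proof.
(* The empty state space is set apart because the matrices below have size [N.+1]; there all sums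
   are empty and [q = 1] works. *)
case EX: X => [|x0 Y] UT.
  by exists 1; [exact: monic1|move=> m; rewrite big1 // => i _; rewrite big_nil mulr0].
rewrite -EX in UT *; pose N := size Y.
have sX : size X = N.+1 by rewrite EX.
have sumX (F : S -> R) : \sum_(s <- X) F s = \sum_(i < N.+1) F (nth x0 X i).
  by rewrite (big_nth x0) big_mkord sX.
pose A := \matrix_(i < N.+1, j < N.+1) T (nth x0 X i) (nth x0 X j).
pose u n := \col_(i < N.+1) U n (nth x0 X i).
pose b := \row_(i < N.+1) c (nth x0 X i).
have uS n : u n.+1 = A *m u n.
  apply/matrixP => i j; rewrite !mxE UT ?mem_nth ?sX // sumX.
  by apply: eq_bigr => k _; rewrite !mxE.
have uD m i : u (m + i)%N = A ^+ i *m u m.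
  elim: i => [|i IHi]; first by rewrite addn0 mul1mx.
  by rewrite addnS uS IHi mulmxA mulmxE -exprS.
exists (char_poly A) => [|m]; first exact: char_poly_monic.
(* Expanding the characteristic polynomial at [A] in this vanishing product gives the recurrence, as
   [A ^+ i *m u m] is [u (m + i)]. *)
have E : (b *m (horner_mx A (char_poly A) *m u m)) 0 0 = 0.
  by rewrite Cayley_Hamilton mul0mx mulmx0 mxE.
rewrite -[RHS]E -[X in horner_mx A X](coefK (char_poly A)).
rewrite poly_def linear_sum mulmx_suml mulmx_sumr summxE.
apply: eq_bigr => i _; rewrite linearZ rmorphXn /= horner_mx_X -scalemxAl -scalemxAr.
rewrite mxE; congr (_ * _); rewrite -uD !mxE sumX.
by apply: eq_bigr => k _; rewrite !mxE.
Qed.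

(** Multiplied by the reversal of [q], the series has as coefficients of y^m, for m at least the
    degree of [q], exactly the left-hand sides of the recurrence; the product is therefore a
    polynomial. *)
Lemma is_rational_recurrence (a : nat -> {poly ratfun}) (q : {poly {poly ratfun}}) :
    q \is monic -> (forall m, \sum_(i < size q) q`_i * a (m + i)%N = 0) ->
  is_rational (fun n m => (a m)`_n).
Proof.
move=> q_monic qa; pose d := (size q).-1.
have sq : size q = d.+1 by rewrite /d prednK // size_poly_gt0 monic_neq0.
(* [q] reversed, read as a polynomial in y: its constant coefficient is the leading coefficient 1 of
   [q], so it is nonzero. *)
pose Q j := if (j <= d)%N then q`_(d - j) else 0.
pose B m := \sum_(j < m.+1) Q j * a (m - j)%N.
have B0 m : (d <= m)%N -> B m = 0.
  move=> dm; rewrite -[RHS](qa (m - d)%N) sq /B.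
  rewrite -(subnK dm) addnC -addSn big_split_ord /= [X in _ + X]big1 ?addr0.
    rewrite (reindex_inj rev_ord_inj) /=; apply: eq_bigr => i _.
    rewrite /Q subSS leq_subr subKn ?leq_ord //; congr (_ * a _).
    by have := ltn_ord i; lia.
  by move=> i _; rewrite /Q leqNgt ltn_addr // mul0r.
(* [d.+1] bounds the exponents of y in [Q] and [B], the two maxima bound those of x. *)
pose N := maxn d.+1 (maxn (\max_(j < d.+1) size (Q j)) (\max_(m < d) size (B m))).
apply: (@is_rationalP _ (fun n m => (Q m)`_n) (fun n m => (B m)`_n) N).
- move=> n m Nnm; split.
    have [md|dm] := leqP m d; last by rewrite /Q leqNgt dm coef0.
    apply: nth_default; have := @leq_bigmax _ (fun j : 'I_d.+1 => size (Q j)) (Ordinal (md : (m < d.+1)%N)).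
    move/leq_trans; apply; case/orP: Nnm; rewrite !geq_max; first by case/and3P.
    by case/and3P; rewrite ltnNge md.
  have [dm|md] := leqP d m; first by rewrite B0 ?coef0.
  apply: nth_default; have := @leq_bigmax _ (fun j : 'I_d => size (B j)) (Ordinal md).
  move/leq_trans; apply; case/orP: Nnm; rewrite !geq_max; first by case/and3P.
  by case/and3P; rewrite ltnNge ltnW.
- by exists 0%N, 0%N; rewrite /Q subn0 -/(lead_coef q) (monicP q_monic) coef1 oner_neq0.
apply/funext => n; apply/funext => m; rewrite /fps2_mul /B coef_sum exchange_big.
by apply: eq_bigr => j _; rewrite coefM.
Qed.

(** * Cutting walks at a column and merging the parts *)

Section Columns.
Variable h : nat.
Implicit Types (u v w : vertex h) (p q r s t : seq (vertex h)).

Definition upto k u := (u.1 <= k)%N.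
Definition from a u := (a <= u.1)%N.

(* A pair in column [k] may be separated by an excursion to the right of [k]. *)
Definition cut_rel k u w := adj u w || (u.1 == k) && (w.1 == k).
(** In a window of columns [a] to [b], a pair in column [a] may also be separated by an excursion to
    the left. *)
Definition window_rel a b u w := cut_rel b u w || (u.1 == a) && (w.1 == a).

Lemma adj_col u w : adj u w -> (w.1 <= u.1.+1)%N && (u.1 <= w.1.+1)%N.
Proof.
case: u w => [i x] [j y]; rewrite /adj /= => /eqP uw.
have := sqr_ge0 (x%:Z - y%:Z); move: uw; set c := (x%:Z - y%:Z) ^+ 2 => uw c0.
by apply/andP; split; rewrite leqNgt; apply/negP => ?; nia.
Qed.

(** Induction with [u] the last vertex and [u0] the last kept one: either they coincide, or [u] is
    on an excursion in column [k.+1] that left from [u0] in column [k]. The excursion can only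
    return to column [k], which [cut_rel k] allows. *)
Lemma path_cut_upto k u u0 p :
    u = u0 /\ (u.1 <= k)%N \/ u.1 = k.+1 /\ u0.1 = k ->
  all (upto k.+1) p -> path (cut_rel k.+1) u p ->
  path (cut_rel k) u0 (filter (upto k) p).
Proof.
elim: p u u0 => //= w p IHp u u0 uu0 /andP[wk1 pk1] /andP[uw wp].
case: ifP => [wk|/negbT wk] /=; last first.
  have {}uu0 : u.1 = u0.1 /\ (u.1 <= k)%N \/ u.1 = k.+1 /\ u0.1 = k.
    by case: uu0 => [[<- ?]|]; [left|right].
  apply: (IHp w) => //; right; move: uw wk wk1; rewrite /cut_rel /upto.
  by case/orP => [/adj_col|/andP[/eqP+ /eqP]]; lia.
apply/andP; split; last by apply: (IHp w) => //; left.
move: uw wk; rewrite /cut_rel {1}/upto; case: uu0 => [[<- _]|[uk u0k]].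
  by case: (adj u w) => //= /andP[/eqP uk /eqP ->]; rewrite ltnn.
by move=> uw wk; apply/orP; right; move: uw => /orP[/adj_col|/andP[_ /eqP]]; lia.
Qed.

(** Mirror image of [path_cut_upto]: excursions now leave column [a] to the left and return to
    column [a]. [u0] need not be a vertex of the walk, which serves for a walk that starts to the
    left of the window. *)
Lemma path_cut_from a b u u0 p : (a < b)%N ->
    u = u0 /\ (a <= u.1)%N \/ (u.1 < a)%N /\ u0.1 = a ->
  path (cut_rel b) u p -> path (window_rel a b) u0 (filter (from a) p).
Proof.
move=> ab; elim: p u u0 => //= w p IHp u u0 uu0 /andP[uw wp].
case: ifP => [aw|/negbT aw] /=; last first.
  have {}uu0 : u.1 = u0.1 /\ (a <= u.1)%N \/ (u.1 < a)%N /\ u0.1 = a.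
    by case: uu0 => [[<- ?]|]; [left|right].
  apply: (IHp w) => //; right; move: uw aw; rewrite /cut_rel /from.
  by case/orP => [/adj_col|/andP[/eqP+ /eqP]]; lia.
apply/andP; split; last by apply: (IHp w) => //; left.
move: uw aw; rewrite /window_rel /from; case: uu0 => [[<- _]|[ua u0a]].
  by move->.
by rewrite /cut_rel; case/orP => [/adj_col|/andP[/eqP+ /eqP]]; lia.
Qed.

(* After a vertex [u] with [u.1 <= a] the next vertex lies in the left part,
   and otherwise in the right part. *)
Lemma path_cut_inj a k u p q : (a < k)%N ->
    path (cut_rel k.+1) u p -> path (cut_rel k.+1) u q ->
    filter (upto k) p = filter (upto k) q ->
    filter (from a) p = filter (from a) q ->
  p = q.
Proof.
move=> ak; have cover w : upto k w || from a w by rewrite /upto /from; lia.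
have filter_nil s : [::] = filter (upto k) s -> [::] = filter (from a) s -> [::] = s.
  by case: s => //= w s; have := cover w; case: (upto k w) => //= ->.
elim: p u q => [u q _ _|x p IHp u [|y q]]; first exact: filter_nil.
  by move=> _ _ /esym/filter_nil eq_p /esym/eq_p.
move=> /= /andP[ux xp] /andP[uy yq].
have next w : cut_rel k.+1 u w -> if (u.1 <= a)%N then upto k w else from a w.
  rewrite /cut_rel /upto /from; case: leqP => ua /orP[/adj_col|/andP[/eqP+ /eqP]]; lia.
move: (next x ux) (next y uy); case: ifP => _.
  move=> -> -> [eq_xy eq_k]; rewrite -eq_xy in yq *.
  by case: ifP => _ => [[eq_a]|eq_a]; rewrite (IHp x q).
move=> -> -> eq_k [eq_xy eq_a]; move: eq_k; rewrite -eq_xy in yq *.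
by case: ifP => _ => [[eq_k]|eq_k]; rewrite (IHp x q).
Qed.

(* [u] is the last vertex of the merged walk, [v] and [w] are the last vertices
   of its left and right parts. *)
Lemma path_cut_merge a k u v w r t : (a < k)%N ->
    [\/ [/\ u = v, u = w, (a <= u.1)%N & (u.1 <= k)%N],
        [/\ u = v, (u.1 < a)%N & w.1 = a]
      | [/\ u = w, u.1 = k.+1 & v.1 = k]] ->
    path (cut_rel k) v r -> path (window_rel a k.+1) w t ->
    all (upto k) r -> all (fun x => from a x && upto k.+1 x) t ->
    filter (from a) r = filter (upto k) t ->
  exists p, [/\ path (cut_rel k.+1) u p, filter (upto k) p = r
              & filter (from a) p = t].
Proof.
(* Induction on the total size: a vertex in columns [a] to [k] uses up the heads of both lists, any
   other vertex the head of only one. *)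
move=> ak; have [n] := ubnP (size r + size t)%N.
elim: n u v w r t => // n IHn u v w r t srt uvw vr wt rk at_ eq_rt.
have [ua|ua] := leqP u.1 a.
  have {uvw}[uv wa] : u = v /\ w.1 = a.
    by case: uvw => [[<- <- ? ?]|[<-]|[]] *; split=> //; lia.
  (* As [w] is in column [a], the head of [t] is in a column at most [k], so it is shared: [t] can
     advance only together with [r]. *)
  have notk y t' : t = y :: t' -> upto k y.
    move=> et; move: wt; rewrite et /= /window_rel /cut_rel /upto => /andP[wy _].
    by move: wy => /orP[/orP[/adj_col|/andP[/eqP+ /eqP]]|/andP[/eqP+ /eqP]]; lia.
  case: r => [|x r] /= in srt vr rk eq_rt *.
    exists [::]; case: t => [//|y t] in srt wt at_ eq_rt notk *.
    by move: eq_rt; rewrite /= (notk y t).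
  case/andP: vr => vx xr; case/andP: rk => xk rk.
  have ux : cut_rel k.+1 u x.
    move: vx; rewrite -uv /cut_rel => /orP[->//|/andP[/eqP+ _]]; lia.
  move: eq_rt; rewrite {1}/from; case: leqP => [ax|xa].
    case: t => [//|y t] in srt wt at_ notk *.
    rewrite /= (notk y t) // => -[exy eq_rt]; rewrite -exy in wt at_.
    case/andP: wt => _ xt; case/andP: at_ => _ {}at_.
    have [||p [xp <- <-]] := IHn x x x r t _ _ xr xt rk at_ eq_rt.
    - by move: srt => /=; lia.
    - by constructor 1.
    by exists (x :: p); rewrite /= ux xp xk (ax : from a x) exy.
  move=> eq_rt.
  have [||p [xp <- <-]] := IHn x x w r t _ _ xr wt rk at_ eq_rt.
  - by move: srt => /=; lia.
  - by constructor 2.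
  by exists (x :: p); rewrite /= ux xp xk [from a x]leqNgt xa.
have {uvw}[uw av uv] : [/\ u = w, (a < v.1)%N &
    (u = v /\ (u.1 <= k)%N) \/ (u.1 = k.+1 /\ v.1 = k)].
  case: uvw => [[uv uw ? ?]|[]|[uw ? ?]]; try lia; last first.
    by split=> //; [lia|right].
  by split; rewrite -?uv //; left.
(* Symmetrically, [v] is to the right of column [a], so the head of [r] is shared and [r] can
   advance only together with [t]. *)
have nota x r' : r = x :: r' -> from a x.
  move=> er; move: vr; rewrite er /= /cut_rel /from => /andP[vx _].
  by move: vx => /orP[/adj_col|/andP[/eqP+ /eqP]]; lia.
case: t => [|y t] /= in srt wt at_ eq_rt *.
  exists [::]; case: r => [//|x r] in srt vr rk eq_rt nota *.
  by move: eq_rt; rewrite /= (nota x r).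
case/andP: wt => wy yt; case/andP: at_ => /andP[ay yk1] at_.
have uy : cut_rel k.+1 u y.
  by move: wy; rewrite -uw /window_rel => /orP[//|/andP[/eqP+ _]]; lia.
move: eq_rt; rewrite {1}/upto; case: leqP => [yk|ky].
  case: r => [//|x r] in srt vr rk nota *.
  rewrite /= (nota x r) // => -[exy eq_rt]; rewrite exy in vr rk.
  case/andP: vr => _ yr; case/andP: rk => _ {}rk.
  have [||p [yp <- <-]] := IHn y y y r t _ _ yr yt rk at_ eq_rt.
  - by move: srt => /=; lia.
  - by constructor 1.
  by exists (y :: p); rewrite /= uy yp ay (yk : upto k y) exy.
move=> eq_rt.
have [||p [yp <- <-]] := IHn y v y r t _ _ vr yt rk at_ eq_rt.
- by move: srt => /=; lia.
- have {}uv : u.1 = v.1 /\ (u.1 <= k)%N \/ u.1 = k.+1 /\ v.1 = k.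
    by case: uv => [[<- ?]|]; [left|right].
  constructor 3; split=> //; first by move: yk1; rewrite /upto; lia.
  by move: uy; rewrite /cut_rel => /orP[/adj_col|/andP[/eqP+ /eqP]]; lia.
by exists (y :: p); rewrite /= uy yp ay [upto k y]leqNgt ky.
Qed.

Lemma uniq_cover (T : eqType) (P Q : pred T) (s : seq T) :
    {in s, forall x, P x || Q x} ->
  uniq (filter P s) -> uniq (filter Q s) -> uniq s.
Proof.
elim: s => //= x s IHs cover uP uQ; apply/andP; split.
  have /orP[Hx|Hx] := cover x (mem_head _ _).
    by move: uP; rewrite Hx /= mem_filter Hx => /andP[].
  by move: uQ; rewrite Hx /= mem_filter Hx => /andP[].
apply: IHs => [y ys||]; first by rewrite cover // inE ys orbT.
  by move: uP; case: ifP => //= _ /andP[].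
by move: uQ; case: ifP => //= _ /andP[].
Qed.

Definition shift n u : vertex h := ((n + u.1)%N, u.2).

Lemma shift_inj n : injective (shift n).
Proof. by move=> [i x] [j y] [/addnI -> ->]. Qed.

Lemma shiftS n u : shift n.+1 u = shift n (shift 1 u).
Proof. by rewrite /shift /= addnA addn1. Qed.

Lemma adj_shift n u w : adj (shift n u) (shift n w) = adj u w.
Proof. by rewrite /adj /= !PoszD opprD addrACA subrr add0r. Qed.

(** Since [u] is not in column 0, even the left neighbor of [shift n u] is in a column at least
    [n]. *)
Lemma adj_shiftP n u x : (0 < u.1)%N -> adj (shift n u) x -> exists y, x = shift n y.
Proof.
move=> u0 /adj_col /= ux; exists ((x.1 - n)%N, x.2).
by case: x ux => i j /= ux; rewrite /shift /= subnKC //; lia.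
Qed.

Lemma filter_from_shift a n s :
  filter (from (n + a)) (map (shift n) s) = map (shift n) (filter (from a) s).
Proof. by rewrite filter_map; congr map; apply: eq_filter => u; rewrite /= /from leq_add2l. Qed.

Lemma filter_upto_shift k n s :
  filter (upto (n + k)) (map (shift n) s) = map (shift n) (filter (upto k) s).
Proof. by rewrite filter_map; congr map; apply: eq_filter => u; rewrite /= /upto leq_add2l. Qed.

Lemma path_window_shift (a b n : nat) u p :
  path (window_rel (n + a)%N (n + b)%N) (shift n u) (map (shift n) p) =
  path (window_rel a b) u p.
Proof.
rewrite path_map; apply: eq_path => x y /=.
by rewrite /window_rel /cut_rel adj_shift /= !eqn_add2l.
Qed.

(** Lists without repetition over the finite alphabet [X] have length at most [size X]. This makes
    the set of windows finite. *)
Lemma finite_bounded b :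
  finite_set [set s : seq (vertex h) | uniq s /\ all (upto b) s].
Proof.
pose X : seq (vertex h) := [seq (i, x) | i <- iota 0 b.+1, x <- enum 'I_h].
have memX s : all (upto b) s -> {subset s <= X}.
  move=> /allP sb [i x] /sb; rewrite /upto /= => ib.
  by apply/allpairsP; exists (i, x); rewrite mem_iota mem_enum.
suff fin n : finite_set [set s : seq (vertex h) | size s = n /\ all (upto b) s].
  apply: (@sub_finite_set _ _ (\bigcup_(n in `I_(size X).+1)
    [set s : seq (vertex h) | size s = n /\ all (upto b) s])).
    move=> s [us sb]; exists (size s) => //=.
    by rewrite ltnS uniq_leq_size //; exact: memX.
  by apply: bigcup_finite => //; exact: finite_II.
elim: n => [|n IHn].
  by apply: sub_finite_set (finite_set1 [::]) => -[|w p] [].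
apply: (@sub_finite_set _ _ (\bigcup_(x in [set` X])
    (cons x @` [set s : seq (vertex h) | size s = n /\ all (upto b) s]))).
  move=> [|x s] [] //= [sz] /andP[xb sb]; exists x; last by exists s.
  by apply: (memX [:: x]); rewrite ?mem_head //= xb.
by apply: bigcup_finite => // x _; exact: finite_image.
Qed.

End Columns.

Lemma fsbig_partition (T S : choiceType) (R : nmodType) (A : set T) (g : T -> S)
    (X : seq S) (F : T -> R) :
    finite_set A -> uniq X -> (forall x, A x -> g x \in X) ->
  \sum_(x \in A) F x = \sum_(s <- X) \sum_(x \in A `&` [set x | g x = s]) F x.
Proof.
move=> finA uX gX; under [RHS]eq_bigr => s _ do rewrite fsbig_mkcondr fsbig_finite //.
rewrite fsbig_finite // exchange_big; apply: eq_big_seq => x.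
rewrite in_fset_set // inE => /gX gx.
rewrite (bigD1_seq (g x)) //= mem_set // big1 ?addr0 // => s gs.
by rewrite memNset // => /esym/eqP; rewrite (negPf gs).
Qed.

(** * Locality and translation invariance of the factors of a walk *)

Section Weights.
Variables (F : fieldType) (C : F) (h : nat).
Implicit Types (u v w : vertex h) (p q r s t : seq (vertex h)).
Implicit Types (c : pred nat) (D : pred (vertex h)).

Definition trapped s u := `[< forall w, adj u w -> w \in s >].

(* The factor contributed by [u], when [s] lists the visited vertices up to [u]
   and [r] the vertices visited after [u]. *)
Definition step_weight s u r : {poly F} :=
  if r is w :: _ then (step_prob C s u w)%:P * 'X else (trapped s u)%:R.

(** [s] accumulates the visited vertices. Selecting columns by [c] allows the factors of a walk to
    be distributed over successive windows. *)
Fixpoint weight c s r : {poly F} :=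
  if r is u :: r' then
    (if c u.1 then step_weight (rcons s u) u r' else 1) * weight c (rcons s u) r'
  else 1.

Lemma eq_weight c c' s r :
  (forall u, u \in r -> c u.1 = c' u.1) -> weight c s r = weight c' s r.
Proof.
elim: r s => //= u r IHr s cc'; rewrite cc' ?mem_head // IHr // => w wr.
by rewrite cc' // inE wr orbT.
Qed.

Lemma weight_split c c' s r : (forall i, ~~ (c i && c' i)) ->
  weight (predU c c') s r = weight c s r * weight c' s r.
Proof.
move=> cc'; elim: r s => [|u r IHr] s /=; first by rewrite mulr1.
rewrite IHr mulrACA; congr (_ * _); move: (cc' u.1).
by case: (c u.1) (c' u.1) => [] [] //= _; rewrite ?mulr1 ?mul1r.
Qed.

(** The energy of a neighbor [x] of [u] counts visited neighbors of [x], which are at most two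
    columns away from [u]. *)
Lemma step_prob_filter D s u w : adj u w ->
    (forall x, (x.1 <= u.1.+2)%N -> (u.1 <= x.1.+2)%N -> D x) ->
  step_prob C s u w = step_prob C (filter D s) u w.
Proof.
move=> uw uD.
have energyD x : adj u x -> energy C s u x = energy C (filter D s) u x.
  move=> ux; rewrite /energy count_filter; congr (_ ^+ _).
  apply: eq_count => y /=; rewrite andbC.
  case xy: (adj x y); rewrite ?andbF //= andbT uD ?andbT //.
  - by have := adj_col ux; have := adj_col xy; lia.
  - by have := adj_col ux; have := adj_col xy; lia.
rewrite /step_prob energyD //; congr (_ / _).
have -> : unvisited (filter D s) u = unvisited s u.
  apply/seteqP; split=> x [ux xs]; split=> //; move: xs;
  by rewrite mem_filter uD //; have := adj_col ux; lia.
by apply: eq_fsbigr => x; rewrite inE => -[ux _]; exact: energyD.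
Qed.

(** By sortedness the successor of a weighted vertex is a neighbor of it, so it satisfies [D] and
    remains the successor after filtering. Vertices outside [D] carry no factor. *)
Lemma weight_filter c D s r :
    sorted (fun u w => c u.1 ==> adj u w) r ->
    (forall u x, c u.1 -> (x.1 <= u.1.+2)%N -> (u.1 <= x.1.+2)%N -> D x) ->
  weight c s r = weight c (filter D s) (filter D r).
Proof.
move=> + cD; elim: r s => //= u r IHr s ur.
rewrite IHr ?(path_sorted ur) // filter_rcons.
have [Du|/negP nDu] := boolP (D u); last first.
  by rewrite ifN ?mul1r //; apply/negP => cu; apply/nDu/(cD u); lia.
rewrite /=; congr (_ * _); case: ifP => // cu.
case: r ur {IHr} => [|w r] /=.
  move=> _; rewrite /trapped; congr ((nat_of_bool (asbool _))%:R); apply/propext; split=> H x ux.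
    by have := H x ux; rewrite !mem_rcons !inE mem_filter (cD u) //; have := adj_col ux; lia.
  by have := H x ux; rewrite !mem_rcons !inE mem_filter (cD u) //; have := adj_col ux; lia.
rewrite cu /= => /andP[uw _].
have -> : D w by apply: (cD u) => //; have := adj_col uw; lia.
by rewrite /= (step_prob_filter (D := D)) ?filter_rcons ?Du // => x; exact: cD.
Qed.

Lemma step_prob_shift n s u w : (0 < u.1)%N ->
  step_prob C (map (shift n) s) (shift n u) (shift n w) = step_prob C s u w.
Proof.
move=> u0.
have energy_shift x : energy C (map (shift n) s) (shift n u) (shift n x) = energy C s u x.
  rewrite /energy count_map; congr (_ ^+ _); apply: eq_count => y /=.
  by rewrite adj_shift (inj_eq (@shift_inj _ n)).
rewrite /step_prob energy_shift; congr (_ / _).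
rewrite (reindex_fsbig (shift n) (unvisited s u)).
  by apply: eq_fsbigr => x _.
split.
- by move=> x [ux xs]; split; rewrite ?adj_shift // mem_map //; exact: shift_inj.
- by move=> x y _ _; exact: shift_inj.
move=> x [/[dup] ux /(adj_shiftP u0)[y ex]]; rewrite ex in ux *.
rewrite mem_map => [ys|]; last exact: shift_inj.
by exists y => //; split=> //; rewrite -(adj_shift n).
Qed.

Lemma trapped_shift n s u : (0 < u.1)%N ->
  trapped (map (shift n) s) (shift n u) = trapped s u.
Proof.
move=> u0; congr asbool; apply/propext; split=> H x ux.
  by have := H (shift n x); rewrite adj_shift mem_map; [exact|exact: shift_inj].
have [y ex] := adj_shiftP u0 ux; rewrite ex in ux *.
by rewrite map_f // H // -(adj_shift n).
Qed.

Lemma weight_shift c n s r : (forall i, c (n + i)%N -> (0 < i)%N) ->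
  weight c (map (shift n) s) (map (shift n) r) = weight (fun i => c (n + i)%N) s r.
Proof.
move=> c0; elim: r s => //= u r IHr s; rewrite -map_rcons IHr; congr (_ * _).
case: ifP => // /c0 u0; case: r {IHr} => [|w r] /=; first by rewrite trapped_shift.
by rewrite step_prob_shift.
Qed.

(** For empty [s] the product is [gsaw_prob], and the first factor singles out the trapped walks; a
    general [s] is what the induction needs. *)
Lemma weight_predT s u p :
  weight predT s (u :: p) =
    (trapped (s ++ u :: p) (last u p))%:R *
    (\prod_(i < size p)
      step_prob C (s ++ u :: take i p) (nth u (u :: p) i) (nth u p i))%:P *
    'X^(size p).
Proof.
elim: p u s => [|w p IHp] u s.
  by rewrite /= big_ord0 expr0 !mulr1 cats1.
rewrite [LHS]/= -/(weight predT _ (w :: p)) IHp cat_rcons.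
have -> : \prod_(i < size (w :: p)) step_prob C (s ++ u :: take i (w :: p))
      (nth u (u :: w :: p) i) (nth u (w :: p) i) =
    step_prob C (rcons s u) u w * \prod_(i < size p)
      step_prob C (s ++ [:: u, w & take i p]) (nth w (w :: p) i) (nth w p i).
  rewrite big_ord_recl; congr (_ * _); first by rewrite /= cats1.
  (* Only the default value of [nth] differs, and [i] is in range. *)
  apply: eq_bigr => i _; rewrite lift0 /=; congr (step_prob _ _ _ _).
    by apply: set_nth_default; exact: ltnW (ltn_ord i).
  exact: set_nth_default.
rewrite (polyCM (step_prob _ _ _ _)) exprS.
under [in LHS]eq_bigr => i _ do rewrite cat_rcons.
by rewrite [LHS](AC (2*(2*1)) ((3*(1*4))*(2*5))).
Qed.

End Weights.

(** * The linear recursion for sums over cut walks with a given window *)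

Section Transfer.
Variables (F : fieldType) (C : F) (h : nat) (v : vertex h).
Hypothesis v_col0 : v.1 = 0%N.
Implicit Types (u w : vertex h) (p q r s t : seq (vertex h)).

Definition cuts k : set (seq (vertex h)) :=
  [set p | [/\ path (cut_rel k) v p, uniq (v :: p) & all (upto k) p]].

Lemma finite_cuts k : finite_set (cuts k).
Proof. by apply: sub_finite_set (finite_bounded h k) => p [_ /andP[_ up] pk]. Qed.

Lemma upto_cons k p : filter (upto k) (v :: p) = v :: filter (upto k) p.
Proof. by rewrite /= {1}/upto v_col0. Qed.

Lemma from_cons a p : (0 < a)%N -> filter (from a) (v :: p) = filter (from a) p.
Proof. by move=> a0; rewrite /= {1}/from v_col0 leqNgt a0. Qed.

Lemma cuts_upto k p : cuts k.+1 p -> cuts k (filter (upto k) p).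
Proof.
case=> vp up pk; split; last exact: filter_all.
  by apply: path_cut_upto pk vp; left; rewrite v_col0.
by rewrite -upto_cons filter_uniq.
Qed.

(** Jumps start in column [k], so the sortedness required by [weight_filter] holds as soon as [c]
    does not select column [k]. *)
Lemma cuts_sorted k (c : pred nat) p : ~~ c k -> cuts k p ->
  sorted (fun u w => c u.1 ==> adj u w) (v :: p).
Proof.
move=> ck [vp _ _]; apply: sub_path vp => u w /orP[->|/andP[/eqP-> _]].
  exact: implybT.
by rewrite (negPf ck).
Qed.

(** Columns are renumbered from 0, so that windows at all positions share one state space; the
    truncated subtraction is exact on the kept vertices. *)
Definition window n p : seq (vertex h) :=
  [seq ((u.1 - n)%N, u.2) | u <- filter (from n) (v :: p)].

Lemma windowP n p t :
  window n p = t <-> filter (from n) (v :: p) = map (shift n) t.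
Proof.
rewrite /window; set s := filter _ _; split=> [<-|->].
  rewrite -map_comp map_id_in // => -[i x]; rewrite mem_filter => /andP[ni _].
  by rewrite /= /shift /= subnKC.
by rewrite -map_comp map_id_in // => -[i x] _; rewrite /= addKn.
Qed.

Lemma window_bounded n k p : cuts (n + k) p -> uniq (window n p) /\ all (upto k) (window n p).
Proof.
move=> [_ up pk]; have := windowP n p (window n p) => -[/(_ erefl) e _].
split; first by rewrite -(map_inj_uniq (@shift_inj _ n)) -e filter_uniq.
apply/allP => u uw; have : shift n u \in map (shift n) (window n p) by rewrite map_f.
rewrite -e mem_filter inE => /andP[_ /predU1P[|/(allP pk)]].
  by move=> /(congr1 fst) /=; rewrite v_col0 /upto; lia.
by rewrite /upto /= leq_add2l.
Qed.

(* The columns before [n.+3] are those whose factors are determined by the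
   columns up to [n + 4]. *)
Definition cut_weight n p := weight C (fun i => i < n.+3)%N [::] (v :: p).

Definition window_sum n t :=
  \sum_(p \in cuts (n + 4) `&` [set p | window n p = t]) cut_weight n p.

(** [t] is the window at [n] and [t'] the one at [n.+1]; they must agree on their four common
    columns. Starting the path at [v] lets [t'] begin anywhere in its column 0, where the walk
    enters from the left. The new factors are those of the middle column, which has two columns of
    the window on each side. *)
Definition transfer t' t :=
  if path (window_rel 0 4) v t' &&
     (filter (from 1) t == map (shift 1) (filter (upto 3) t'))
  then weight C (pred1 2) [::] t' else 0.

(** The columns before [n.+3] see only columns up to [n + 4], and column [n.+3], the middle of the
    new window, sees only that window. *)
Lemma cut_weightS n p t : cuts (n.+1 + 4) p -> window n.+1 p = t ->
  cut_weight n.+1 p =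
    cut_weight n (filter (upto (n + 4)) p) * weight C (pred1 2) [::] t.
Proof.
move=> cp /windowP pt.
rewrite /cut_weight (eq_weight _ (c' := predU (fun i => i < n.+3)%N (pred1 n.+3))); last first.
  by move=> u _ /=; lia.
rewrite weight_split; last by move=> i /=; lia.
rewrite (weight_filter _ (D := upto (n + 4)) (c := fun i => (i < n.+3)%N)); first last.
- by move=> u x; rewrite /upto; lia.
- by apply: (cuts_sorted (c := fun i => (i < n.+3)%N) _ cp); lia.
rewrite (weight_filter _ (D := from n.+1) (c := pred1 n.+3)); first last.
- by move=> u x /=; rewrite /from; lia.
- by apply: (cuts_sorted (c := pred1 n.+3) _ cp); rewrite /=; lia.
rewrite upto_cons pt; congr (_ * _).
transitivity (weight C (pred1 n.+3) (map (shift n.+1) [::]) (map (shift n.+1) t)) => //.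
rewrite weight_shift => [|i /=]; last by lia.
by apply: eq_weight => u _ /=; lia.
Qed.

(** Injectivity is [path_cut_inj], surjectivity is [path_cut_merge]; the two parts overlap in
    columns 0 to 3 of [t]. *)
Lemma cuts_bij n t : uniq t -> all (upto 4) t -> path (window_rel 0 4) v t ->
  set_bij (cuts (n.+1 + 4) `&` [set p | window n.+1 p = t])
    (cuts (n + 4) `&` [set p | filter (from n.+1) (v :: p) =
       map (shift n.+1) (filter (upto 3) t)])
    (filter (upto (n + 4))).
Proof.
move=> ut t4 vt; split.
- move=> p [cp /windowP pt]; split; first exact: cuts_upto.
  suff: filter (from n.+1) (v :: filter (upto (n + 4)) p) =
      map (shift n.+1) (filter (upto 3) t) by [].
  rewrite -upto_cons -filter_upto_shift -pt addSnnS -!filter_predI.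
  by apply: eq_filter => u /=; rewrite andbC.
- move=> p q; rewrite !inE => -[[vp _ _] /windowP pt] [[vq _ _] /windowP qt] pq.
  apply: (path_cut_inj (a := n.+1) (k := n + 4) _ vp vq pq); first by lia.
  by move: pt qt; rewrite !from_cons // => -> ->.
move=> q [[vq uq qn] /= qt].
(* The virtual vertex [shift n.+1 v], in the first column of the window, plays the last vertex of
   the right part before the walk has entered the window. *)
have [|||||p [vp pq pt]] := path_cut_merge (a := n.+1) (k := n + 4) (u := v)
  (w := shift n.+1 v) (t := map (shift n.+1) t) _ _ vq _ qn.
- by lia.
- by constructor 2; rewrite /= v_col0 addn0.
- by have := path_window_shift 0 4 n.+1 v t; rewrite addn0 => ->.
- by rewrite all_map; apply: sub_all t4 => u; rewrite /from /upto /=; lia.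
- by rewrite -[(n + 4)%N]addSnnS filter_upto_shift -from_cons.
have cover u : upto (n + 4) u || from n.+1 u by rewrite /upto /from; lia.
exists p => //; split; last by apply/windowP; rewrite from_cons.
split=> //.
  apply: (uniq_cover (P := upto (n + 4)) (Q := from n.+1)) => //.
    by rewrite upto_cons pq.
  by rewrite from_cons // pt map_inj_uniq //; exact: shift_inj.
apply/allP => u up; have /orP[un|nu] := cover u; first by move: un; rewrite /upto; lia.
have : u \in filter (from n.+1) p by rewrite mem_filter nu.
by rewrite pt => /mapP[x /(allP t4)]; rewrite /upto => x4 -> /=; lia.
Qed.

(** Dropping the last column turns the cut walks with window [t'] into those that agree with [t'] on
    the overlap; these are then grouped by their window [t] at [n]. *)
Lemma window_sum_rec X n t' :
    uniq X -> (forall t, t \in X <-> uniq t /\ all (upto 4) t) -> t' \in X ->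
  window_sum n.+1 t' = \sum_(t <- X) transfer t' t * window_sum n t.
Proof.
move=> uX memX /memX[ut' t'4].
rewrite /transfer; case: (boolP (path _ v t')) => [vt'|nvt']; last first.
  rewrite [RHS]big1 => [|t _]; last by rewrite mul0r.
  apply: fsbig1 => p [[vp _ _] /windowP]; rewrite from_cons // => pt.
  case/negP: nvt'; rewrite -(path_window_shift 0 4 n.+1) -pt addn0.
  by apply: path_cut_from vp; [lia|right; rewrite /= v_col0 addn0].
rewrite /= /window_sum (eq_fsbigr (fun p => cut_weight n (filter (upto (n + 4)) p) *
  weight C (pred1 2) [::] t')); last first.
  by move=> p; rewrite inE => -[cp /= pt]; exact: cut_weightS.
rewrite -(reindex_fsbig _ _ _ (fun q => cut_weight n q * weight C (pred1 2) [::] t')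
  (cuts_bij n ut' t'4 vt')).
rewrite -mulr_fsuml (fsbig_partition _ (g := window n) (X := X)) //; first last.
- by move=> p [cp _]; apply/memX/window_bounded.
- exact: finite_setIl (finite_cuts _).
rewrite mulr_suml; apply: eq_bigr => t _.
have from_window p : window n p = t ->
    filter (from n.+1) (v :: p) = map (shift n) (filter (from 1) t).
  move=> /windowP e; rewrite -filter_from_shift -e -filter_predI.
  by apply: eq_filter => u; rewrite /= /from; lia.
have shiftSmap s : map (shift n.+1) s = map (shift n) (map (shift 1) s).
  by rewrite -map_comp; apply: eq_map => u; exact: shiftS.
(* Once [t] is fixed, agreement on the overlap holds for all cut walks of the group or for none. *)
case: eqP => [e|ne]; last first.
  rewrite mul0r fsbig1 ?mul0r // => p [[_ /= pt'] /from_window pt].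
  by case: ne; apply: (inj_map (@shift_inj _ n)); rewrite -shiftSmap -pt.
rewrite mulrC; congr (_ * _); apply: eq_fsbigl; apply/seteqP; split=> p.
  by move=> [[cp _] pt].
move=> [cp pt]; split=> //; split=> //.
by have := from_window p pt; rewrite e -shiftSmap.
Qed.

(** * Displacement and the windows that end the recursion *)

Lemma displacement_col0 m p :
  displacement v p = m <-> all (upto m) p /\ has (from m) (v :: p).
Proof.
(* The start [v] is in column 0, so the displacement is the largest column reached. *)
have min0 : \big[minn/v.1]_(u <- p) u.1 = 0%N.
  by rewrite v_col0; elim: p => [|u p IHp]; rewrite ?big_nil // big_cons IHp minn0.
have from_v : from m v = (m <= 0)%N by rewrite /from v_col0.
rewrite /displacement min0 subn0 v_col0 /= from_v.
have maxle : (\max_(u <- p) u.1 <= m)%N = all (upto m) p.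
  by elim: p {min0} => [|u p IHp]; rewrite ?big_nil // big_cons geq_max IHp.
have lemax : (m <= \max_(u <- p) u.1)%N = (m <= 0)%N || has (from m) p.
  elim: p {min0 maxle} => [|u p IHp]; rewrite ?big_nil ?orbF // big_cons leq_max IHp /=.
  by rewrite orbCA.
rewrite -maxle -lemax; split=> [->//|[le_m ge_m]].
by apply/eqP; rewrite eqn_leq le_m.
Qed.

(** Column 0 of the window at [m] is column [m]: the walk reaches it and does not go beyond. *)
Definition final t : bool := (t != [::]) && all (upto 0) t.

Lemma final_window m p : final (window m p) <-> displacement v p = m.
Proof.
have /windowP e : window m p = window m p by [].
apply: iff_trans (iff_sym (displacement_col0 m p)).
have -> : all (upto m) p = all (upto m) (filter (from m) (v :: p)).
  rewrite all_filter /= {2}/upto v_col0 implybT.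
  by apply: eq_all => u; rewrite /= /upto /from; lia.
rewrite has_filter e -!size_eq0 size_map size_eq0 all_map /final.
rewrite (eq_all (a2 := upto 0)) => [|u]; last by rewrite /= /upto /=; lia.
by rewrite andbC; split=> /andP.
Qed.

Lemma cut_weight_gsaw m p : all (upto m) p ->
  cut_weight m p = if trapped (v :: p) (last v p)
    then (gsaw_prob C v p)%:P * 'X^(size p) else 0.
Proof.
move=> pm; rewrite /cut_weight (eq_weight _ (c' := predT)); last first.
  by move=> u; rewrite inE => /predU1P[->|/(allP pm)]; rewrite ?v_col0 // /upto /=; lia.
by rewrite weight_predT /=; case: trapped; rewrite ?mul1r // !mul0r.
Qed.

(** A cut walk with a final window stays away from column [m + 4], so it has no jumps: it is a
    genuine self-avoiding walk of displacement [m], and all its factors are in [cut_weight]. The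
    factor of its last vertex keeps exactly the trapped ones. *)
Lemma window_sum_final X m :
    uniq X -> (forall t, t \in X <-> uniq t /\ all (upto 4) t) ->
  \sum_(t <- X) (final t)%:R * window_sum m t =
    \sum_(p \in gsaws v `&` [set p | displacement v p = m])
      (gsaw_prob C v p)%:P * 'X^(size p).
Proof.
move=> uX memX.
pose G p := if final (window m p) then cut_weight m p else 0.
transitivity (\sum_(p \in cuts (m + 4)) G p).
  rewrite (fsbig_partition _ (g := window m) (X := X)) //; first last.
  - by move=> p cp; apply/memX/window_bounded.
  - exact: finite_cuts.
  apply: eq_bigr => t _; rewrite /window_sum mulr_fsumr.
  apply: eq_fsbigr => p; rewrite inE => -[_ /= pt]; rewrite /G pt.
  by case: final; rewrite ?mul1r ?mul0r.
have -> : gsaws v `&` [set p | displacement v p = m] =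
    cuts (m + 4) `&` [set p | displacement v p = m /\ trapped (v :: p) (last v p)].
  apply/seteqP; split=> p.
    move=> [[vp up tr] /[dup] /displacement_col0[pm _] pd]; split; last first.
      by split=> //; apply/asboolP.
    split=> //; last by apply: sub_all pm => u; rewrite /upto; lia.
    by apply: sub_path vp => u w uw; rewrite /cut_rel uw.
  move=> [[vp up _] [/[dup] pd /displacement_col0[pm _] /asboolP tr]].
  split=> //; split=> //.
  apply: (sub_in_path (P := upto m)) vp; last by rewrite /= pm {1}/upto v_col0.
  by move=> u w um wm; rewrite /cut_rel; move: um; rewrite unfold_in /upto => um /orP[//|/andP[]]; lia.
rewrite fsbig_mkcondr; apply: eq_fsbigr => p _; rewrite /G.
case: ifP => [/final_window|/negP nf].
  move=> /[dup] pd /displacement_col0[pm _]; rewrite (cut_weight_gsaw pm).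
  by case: ifP => tr; [rewrite mem_set|rewrite memNset // => -[]; rewrite tr].
by rewrite memNset // => -[/final_window].
Qed.

Lemma coef_gsaw_sum n m :
  (\sum_(p \in gsaws v `&` [set p | displacement v p = m])
      (gsaw_prob C v p)%:P * 'X^(size p))`_n =
  \sum_(p \in gsaws v `&` [set p | size p = n /\ displacement v p = m])
      gsaw_prob C v p.
Proof.
have fin : finite_set (gsaws v `&` [set p | displacement v p = m]).
  apply: sub_finite_set (finite_bounded h m) => p [[_ /andP[_ up] _]].
  by move=> /displacement_col0[].
have -> : gsaws v `&` [set p | size p = n /\ displacement v p = m] =
    (gsaws v `&` [set p | displacement v p = m]) `&` [set p | size p = n].
  by apply/seteqP; split=> p; [move=> [? []]|move=> [[]]].
rewrite [RHS]fsbig_mkcondr !fsbig_finite // coef_sum; apply: eq_bigr => p _.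
rewrite coefCM coefXn; case: eqP => [e|ne].
  by rewrite mulr1 mem_set.
by rewrite mulr0 memNset // => /esym.
Qed.

End Transfer.

Theorem theorem5p2 (h : nat) (h_ge1 : (1 <= h)%N) :
  is_rational (gsaw_gf (topleft h_ge1)).
Proof.
set v := topleft h_ge1; have v0 : v.1 = 0%N by [].
(* The states are the lists without repetition in columns 0 to 4. *)
have /finite_seqP[s eX] := finite_bounded h 4.
have memX t : t \in undup s <-> uniq t /\ all (upto 4) t.
  by rewrite mem_undup; have := congr1 (@^~ t) eX => /= ->.
have uX := undup_uniq s.
(* [a m] is the coefficient of y^m, a polynomial in x over Q(C). *)
pose a m := \sum_(t <- undup s) (final t)%:R * window_sum Cvar v m t.
have [q q_monic qa] := transfer_recurrence (T := transfer Cvar v)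
  (fun t => (final t)%:R)
  (fun n t => window_sum_rec Cvar v0 n uX memX).
rewrite (_ : gsaw_gf v = fun n m => (a m)`_n).
  exact: is_rational_recurrence q_monic qa.
apply/funext => n; apply/funext => m.
by rewrite /a window_sum_final // coef_gsaw_sum.
Qed.
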